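(* Let $p$ be an odd prime and let $K$, $L$, $M$, $N$ be integers with $0\le K<K+M<p$ and $0\le L<L+N<p$. For an integer $a$ define $$W_a(K,M;L,N)=\sum_{m=K+1}^{K+M}\ \sum_{n=L+1}^{L+N} \exp\!\left(\frac{2\pi i\, a\, m!\, n!}{p}\right).$$ Then for any integers $k,\ell\ge 1$, $$\max_{\gcd(a,p)=1}|W_a(K,M;L,N)|\ll M^{1-1/(2\ell(k+1))}\,N^{1-1/(2k(\ell+1))}\,p^{1/(2k\ell)}.$$
   Context: The notation $U\ll V$ means $|U|\le cV$ for some constant $c>0$; here $c$ may depend on $k$ and $\ell$ only. *)

(* Defs.v *)
From HB Require Import structures.
From mathcomp Require Import all_boot all_order all_algebra.
From mathcomp Require Import all_classical all_reals all_analysis.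
From mathcomp Require Import complex.
Set Implicit Arguments.
Unset Strict Implicit.
Unset Printing Implicit Defensive.
Import Order.TTheory GRing.Theory Num.Theory.
Local Open Scope ring_scope.
Local Open Scope complex_scope.

(* The complex exponential: exp (x + i y) = exp x * (cos y + i sin y). *)
Definition cexp (R : realType) (z : R[i]) : R[i] :=
  (expR (complex.Re z))%:C * (cos (complex.Im z) +i* sin (complex.Im z)).

Definition W (R : realType) (p : nat) (a : int) (K M L N : nat) : R[i] :=
  \sum_(K.+1 <= m < (K + M).+1) \sum_(L.+1 <= n < (L + N).+1)
    cexp (2 * (pi : R)%:C * 'i%C * a%:~R * (m`!)%:R * (n`!)%:R / p%:R).

(* Main.v *)
(** Let E_k(M) be the number of solutions of
    m_1! + ... + m_k! = m_(k+1)! + ... + m_(2k)! in F_p with all m_i in an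
    interval of length M.  Two applications of Hoelder's inequality followed by
    Cauchy-Schwarz and orthogonality of characters give
    |W|^(2kl) <= p M^(2kl-2k) N^(2kl-2l) E_k(M) E_l(N), so it suffices that
    E_k(M) << M^(2k-1+1/(k+1)).

    Cut the interval into J ~ M/h blocks of length h ~ M^(1/(k+1)).  By Hoelder
    on the moment side, E_k is at most J^(2k-1) times the sum over the blocks of
    the number of solutions inside one block.  Either each m_(k+i) occurs among
    m_1, ..., m_k, which gives O(J h^k) solutions, or, writing m for the least
    of the m_i and m_i = m + h_i, division by m! turns the equation into a
    polynomial equation in m of degree < h.  The latter is nontrivial because
    the polynomials (X+1)...(X+j) are linearly independent and k < p, so there
    are O(h^(2k-1) h) such solutions. *)
Require Import Defs.
From HB Require Import structures.
From mathcomp Require Import all_boot all_order all_algebra.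
From mathcomp Require Import ring zify.
Set Implicit Arguments.
Unset Strict Implicit.
Unset Printing Implicit Defensive.
Import Order.TTheory GRing.Theory Num.Theory.
Local Open Scope ring_scope.

(** * Moments of character sums *)

(** Chebyshev's sum inequality for the similarly ordered families [x] and [x ^+ n]: sum
    [(x i - x j) * (x i ^+ n - x j ^+ n) >= 0] over all pairs. *)
Lemma chebyshev_sum_power (C : numDomainType) (I : finType) (x : I -> C) n :
  (forall i, 0 <= x i) ->
  (\sum_i x i) * (\sum_i x i ^+ n) <= #|I|%:R * \sum_i x i ^+ n.+1.
Proof.
move=> x_ge0.
have pair_le i j :
    x i * x j ^+ n + x j * x i ^+ n <= x i ^+ n.+1 + x j ^+ n.+1.
  have eqd : x i ^+ n.+1 + x j ^+ n.+1 - (x i * x j ^+ n + x j * x i ^+ n)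
      = (x i - x j) * (x i ^+ n - x j ^+ n).
    by rewrite !exprS; ring.
  rewrite -subr_ge0 eqd.
  (* The order of [C] is only partial, but nonnegative elements are comparable, so both factors have
     the same sign. *)
  have /orP[le_ij | le_ji] :=
    real_leVge (ger0_real (x_ge0 i)) (ger0_real (x_ge0 j)).
    by rewrite mulr_le0 // subr_le0 ?lerXn2r ?nnegrE.
  by rewrite mulr_ge0 // subr_ge0 ?lerXn2r ?nnegrE.
have sumE : \sum_i \sum_j (x i * x j ^+ n + x j * x i ^+ n)
    = ((\sum_i x i) * (\sum_i x i ^+ n)) *+ 2.
  under eq_bigr do rewrite big_split /=.
  rewrite big_split /= [X in _ + X]exchange_big /= -mulr2n; congr (_ *+ 2).
  by rewrite mulr_suml; apply: eq_bigr => i _; rewrite mulr_sumr.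
have sumE' : \sum_i \sum_j (x i ^+ n.+1 + x j ^+ n.+1)
    = (#|I|%:R * \sum_i x i ^+ n.+1) *+ 2.
  under eq_bigr do rewrite big_split /=.
  rewrite big_split /= [X in _ + X]exchange_big /= -mulr2n; congr (_ *+ 2).
  by rewrite mulr_sumr; apply: eq_bigr => i _; rewrite sumr_const mulr_natl.
rewrite -(ler_pMn2r (n := 2)) // -sumE -sumE'.
by apply: ler_sum => i _; apply: ler_sum.
Qed.

(** Hoelder's inequality against the constant 1, for integer exponents; each induction step absorbs
    one more factor by Chebyshev. *)
Lemma power_mean (C : numDomainType) (I : finType) (x : I -> C) n :
  (forall i, 0 <= x i) ->
  (\sum_i x i) ^+ n.+1 <= #|I|%:R ^+ n * \sum_i x i ^+ n.+1.
Proof.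
move=> x_ge0; elim: n => [|n IHn]; first by rewrite mul1r.
rewrite exprS (le_trans (ler_wpM2l _ IHn)) ?sumr_ge0 // mulrCA [in leRHS]exprSr.
by rewrite -mulrA ler_wpM2l ?exprn_ge0 // chebyshev_sum_power.
Qed.

(** Lagrange's identity: the defect is half the double sum of [(a i * b j - a j * b i) ^+ 2], a
    square of a real element. *)
Lemma cauchy_schwarz (C : numDomainType) (I : finType) (a b : I -> C) :
  (forall i, 0 <= a i) -> (forall i, 0 <= b i) ->
  (\sum_i a i * b i) ^+ 2 <= (\sum_i a i ^+ 2) * (\sum_i b i ^+ 2).
Proof.
move=> a_ge0 b_ge0.
have pair_le i j : (a i * b i) * (a j * b j) *+ 2
    <= a i ^+ 2 * b j ^+ 2 + a j ^+ 2 * b i ^+ 2.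
  rewrite -subr_ge0.
  have -> : a i ^+ 2 * b j ^+ 2 + a j ^+ 2 * b i ^+ 2
      - (a i * b i) * (a j * b j) *+ 2 = (a i * b j - a j * b i) ^+ 2 by ring.
  by rewrite real_exprn_even_ge0 // rpredB // rpredM // ger0_real.
have sumE : \sum_i \sum_j (a i * b i) * (a j * b j) *+ 2
    = (\sum_i a i * b i) ^+ 2 *+ 2.
  rewrite expr2 mulr_suml -sumrMnl; apply: eq_bigr => i _.
  by rewrite mulr_sumr -sumrMnl.
have sumE' : \sum_i \sum_j (a i ^+ 2 * b j ^+ 2 + a j ^+ 2 * b i ^+ 2)
    = (\sum_i a i ^+ 2) * (\sum_i b i ^+ 2) *+ 2.
  under eq_bigr do rewrite big_split /=.
  rewrite big_split /= [X in _ + X]exchange_big /= -mulr2n; congr (_ *+ 2).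
  by rewrite mulr_suml; apply: eq_bigr => i _; rewrite mulr_sumr.
rewrite -(ler_pMn2r (n := 2)) // -sumE -sumE'.
by apply: ler_sum => i _; apply: ler_sum.
Qed.

(** The set [S] is a parameter so that one notion serves both the whole interval ([setT]) and a
    single block. *)
Definition energy (F : finFieldType) (A : finType) (n : nat) (f : A -> F)
    (S : {set A}) : nat :=
  #|[set w : {ffun 'I_n -> A} * {ffun 'I_n -> A} |
      [&& [forall i, w.1 i \in S], [forall i, w.2 i \in S]
        & \sum_i f (w.1 i) == \sum_i f (w.2 i)]]|.

Lemma prod_indicator (C : numDomainType) (A : finType) (n : nat) (S : {set A})
    (u : {ffun 'I_n -> A}) :
  \prod_i (u i \in S)%:R = [forall i, u i \in S]%:R :> C.
Proof.
case: forallP => [uS | /forallP]; first by rewrite big1 // => i _; rewrite uS.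
by case/forallPn => i /negPf uiS; rewrite (bigD1 i) //= uiS mul0r.
Qed.

Lemma energy_sum (C : numDomainType) (F : finFieldType) (A : finType) (n : nat)
    (f : A -> F) (S : {set A}) :
  \sum_(u : {ffun 'I_n -> A})
    \sum_(v : {ffun 'I_n -> A} | \sum_i f (u i) == \sum_i f (v i))
      (\prod_i (u i \in S)%:R) * (\prod_i (v i \in S)%:R)
  = (energy n f S)%:R :> C.
Proof.
rewrite pair_big_dep /= /energy -sum1_card natr_sum big_mkcond [RHS]big_mkcond.
apply: eq_bigr => -[u v] _; rewrite inE /= !prod_indicator.
case: [forall i, u i \in S]; case: [forall i, v i \in S]; case: (_ == _) => //=;
  by rewrite ?(mul0r, mulr0, mulr1).
Qed.

(** * Orthogonality, moments and the bilinear bound for a nontrivial additive character *)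

Section AdditiveCharacter.

Variables (C : numClosedFieldType) (F : finFieldType) (e : F -> C).
Hypothesis eD : {morph e : x y / x + y >-> x * y}.
Hypothesis norm_e : forall x, `|e x| = 1.
Hypothesis e_nontrivial : exists x, e x != 1.

Let e_neq0 x : e x != 0.
Proof. by rewrite -normr_eq0 norm_e oner_eq0. Qed.

Let e0 : e 0 = 1.
Proof. by apply: (mulfI (e_neq0 0)); rewrite -eD addr0 mulr1. Qed.

Lemma character_conj x : (e x)^* = e (- x).
Proof.
apply: (mulfI (e_neq0 x)).
by rewrite -normCK norm_e expr1n -eD subrr e0.
Qed.

Lemma character_sum (I : finType) (g : I -> F) :
  e (\sum_i g i) = \prod_i e (g i).
Proof. exact: (big_morph e eD e0). Qed.

Lemma character_orthogonality x :
  \sum_t e (t * x) = if x == 0 then #|F|%:R else 0.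
Proof.
have [-> | x_neq0] := eqVneq x 0.
  by rewrite (eq_bigr (fun=> 1)) ?sumr_const // => t _; rewrite mulr0 e0.
have [y ey] := e_nontrivial.
have shift : \sum_t e (t * x) = e y * \sum_t e (t * x).
  rewrite [LHS](reindex_inj (addrI (y / x))) /= mulr_sumr.
  by apply: eq_bigr => t _; rewrite mulrDl divfK // eD.
apply/eqP; move/eqP: shift.
rewrite -subr_eq0 -{1}[\sum_t _]mul1r -mulrBl mulf_eq0 subr_eq0 eq_sym.
by rewrite (negPf ey).
Qed.

(** The values [g i] may repeat, hence a sum over pairs with equal values in place of the
    diagonal. *)
Lemma parseval (I : finType) (a : I -> C) (g : I -> F) :
  \sum_t `|\sum_i a i * e (t * g i)| ^+ 2
  = #|F|%:R * \sum_i \sum_(j | g i == g j) a i * (a j)^*.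
Proof.
have expand t : `|\sum_i a i * e (t * g i)| ^+ 2
    = \sum_i \sum_j a i * (a j)^* * e (t * (g i - g j)).
  rewrite normCK rmorph_sum /= mulr_suml; apply: eq_bigr => i _.
  rewrite mulr_sumr; apply: eq_bigr => j _.
  by rewrite rmorphM /= character_conj mulrACA -eD mulrBr.
under eq_bigr do rewrite expand.
rewrite exchange_big /= mulr_sumr; apply: eq_bigr => i _.
rewrite exchange_big /= mulr_sumr [RHS]big_mkcond; apply: eq_bigr => j _.
rewrite -mulr_sumr character_orthogonality subr_eq0.
by case: eqP => _; rewrite ?mulr0 // mulrC.
Qed.

Lemma power_of_sum (A : finType) (a : A -> C) (f : A -> F) n t :
  (\sum_x a x * e (t * f x)) ^+ n
  = \sum_(u : {ffun 'I_n -> A}) (\prod_i a (u i)) * e (t * \sum_i f (u i)).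
Proof.
rewrite -[n in LHS]card_ord -prodr_const bigA_distr_bigA.
apply: eq_bigr => u _; rewrite big_split /= mulr_sumr character_sum.
by congr (_ * _); apply: eq_bigl => i; rewrite inE.
Qed.

(** Parseval applied to the [n]-th power of the sum, whose frequencies are the sums of [f] over
    [n]-tuples. *)
Lemma moment_expansion (A : finType) (a : A -> C) (f : A -> F) n :
  \sum_t `|\sum_x a x * e (t * f x)| ^+ (n * 2)
  = #|F|%:R * \sum_(u : {ffun 'I_n -> A})
      \sum_(v : {ffun 'I_n -> A} | \sum_i f (u i) == \sum_i f (v i))
        (\prod_i a (u i)) * (\prod_i a (v i))^*.
Proof.
rewrite -parseval; apply: eq_bigr => t _.
by rewrite exprM -normrX power_of_sum.
Qed.

Lemma moment_energy (A : finType) (f : A -> F) (S : {set A}) n :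
  \sum_t `|\sum_(x in S) e (t * f x)| ^+ (n * 2)
  = #|F|%:R * (energy n f S)%:R.
Proof.
rewrite -energy_sum.
transitivity (\sum_t `|\sum_x (x \in S)%:R * e (t * f x)| ^+ (n * 2)).
  apply: eq_bigr => t _; rewrite big_mkcond; congr (`|_| ^+ _).
  by apply: eq_bigr => x _; case: (x \in S); rewrite ?mul1r ?mul0r.
rewrite moment_expansion; congr (_ * _); apply: eq_bigr => u _.
apply: eq_bigr => v _; congr (_ * _); rewrite rmorph_prod.
by apply: eq_bigr => i _; rewrite rmorph_nat.
Qed.

(** The expanded moment runs over the solutions counted by the energy, with coefficients of modulus
    at most 1, so weights cannot push it above the unweighted moment. *)
Lemma weighted_moment_le (A : finType) (a : A -> C) (f : A -> F) n :
  (forall x, `|a x| <= 1) ->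
  \sum_t `|\sum_x a x * e (t * f x)| ^+ (n * 2)
  <= #|F|%:R * (energy n f setT)%:R.
Proof.
move=> a_le1; rewrite -energy_sum.
have prod_le1 (u : {ffun 'I_n -> A}) : `|\prod_i a (u i)| <= 1.
  by rewrite normr_prod; apply: prodr_ile1 => i _; rewrite normr_ge0 a_le1.
have sum_ge0 : 0 <= \sum_t `|\sum_x a x * e (t * f x)| ^+ (n * 2).
  by apply: sumr_ge0 => t _; rewrite exprn_ge0.
rewrite -(ger0_norm sum_ge0) moment_expansion normrM normr_nat ler_wpM2l //.
apply: (le_trans (ler_norm_sum _ _ _)); apply: ler_sum => u _.
apply: (le_trans (ler_norm_sum _ _ _)); apply: ler_sum => v _.
rewrite normrM norm_conjC !prod_indicator.
have all_T (w : {ffun 'I_n -> A}) : [forall i, w i \in [set: A]].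
  by apply/forallP => i; rewrite inE.
by rewrite !all_T mulr1 mulr_ile1.
Qed.

(** Hoelder in [x] with exponent [k.+1] opens the inner sum into [k.+1]-tuples from [B]; Hoelder
    over these tuples with exponent [l.+1], then Cauchy-Schwarz over the values of their sums,
    separates the energies of [g] and [f]. *)
Lemma bilinear_bound (A B : finType) (f : A -> F) (g : B -> F) k l :
  `|\sum_x \sum_y e (f x * g y)| ^+ (k.+1 * l.+1 * 2)
  <= #|F|%:R * #|A|%:R ^+ (k * l.+1 * 2) * #|B|%:R ^+ (k.+1 * l * 2)
     * (energy l.+1 f setT)%:R * (energy k.+1 g setT)%:R.
Proof.
pose s x := \sum_y e (f x * g y).
(* The phase turning |s x|^(k+1) into th x * (s x)^(k+1); it is 0 if s x = 0. *)
pose th x := `|s x| ^+ k.+1 / s x ^+ k.+1.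
have th_le1 x : `|th x| <= 1.
  rewrite normrM normfV !normrX normr_id.
  have [->|s_neq0] := eqVneq (s x) 0.
    by rewrite normr0 expr0n /= mul0r ler01.
  by rewrite divff // expf_neq0 // normr_eq0.
have thE x : `|s x| ^+ k.+1 = th x * s x ^+ k.+1.
  have [sx0|s_neq0] := eqVneq (s x) 0; last by rewrite divfK // expf_neq0.
  by rewrite sx0 normr0 expr0n /= mulr0.
pose D t := `|\sum_x th x * e (t * f x)|.
have D_ge0 t : 0 <= D t by rewrite normr_ge0.
pose G (v : {ffun 'I_k.+1 -> B}) := \sum_i g (v i).
have step1 : `|\sum_x s x| ^+ k.+1 <= #|A|%:R ^+ k * \sum_v D (G v).
  apply: (@le_trans _ _ ((\sum_x `|s x|) ^+ k.+1)).
    by rewrite lerXn2r ?nnegrE ?ler_norm_sum // sumr_ge0.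
  apply: le_trans (power_mean _ _) _ => //.
  rewrite ler_wpM2l ?exprn_ge0 //.
  have pow_ge0 : 0 <= \sum_x `|s x| ^+ k.+1.
    by apply: sumr_ge0 => x _; rewrite exprn_ge0.
  rewrite -(ger0_norm pow_ge0).
  (* With the phase the power is an honest exponential sum, so [x] can be summed first for each
     tuple [v]. *)
  have -> : \sum_x `|s x| ^+ k.+1 = \sum_v \sum_x th x * e (G v * f x).
    rewrite exchange_big /=; apply: eq_bigr => x _.
    rewrite thE -mulr_sumr; congr (_ * _).
    have -> : s x = \sum_y 1 * e (f x * g y).
      by apply: eq_bigr => y _; rewrite mul1r.
    rewrite power_of_sum; apply: eq_bigr => v _.
    by rewrite big1 // mul1r mulrC.
  exact: ler_norm_sum.
have step2 : (\sum_v D (G v)) ^+ l.+1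
    <= #|B|%:R ^+ (k.+1 * l) * \sum_v D (G v) ^+ l.+1.
  rewrite exprM -natrX -[X in (_ ^ X)%N]card_ord -card_ffun.
  exact: power_mean.
(* [J t] is the number of tuples with sum [t]; its second moment is the energy of [g]. *)
pose J t : C := \sum_(v | G v == t) 1.
have J_sqr : \sum_t J t ^+ 2 = (energy k.+1 g setT)%:R.
  rewrite -energy_sum [RHS](partition_big G predT) //=.
  apply: eq_bigr => t _; rewrite expr2 mulr_suml.
  apply: eq_bigr => u /eqP Gu; rewrite mulr_sumr.
  apply: eq_big => [v|v _]; first by rewrite -Gu eq_sym.
  by rewrite !big1 ?mulr1 // => i _; rewrite inE.
have step3 : (\sum_v D (G v) ^+ l.+1) ^+ 2
    <= (energy k.+1 g setT)%:R * (#|F|%:R * (energy l.+1 f setT)%:R).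
  have -> : \sum_v D (G v) ^+ l.+1 = \sum_t J t * D t ^+ l.+1.
    rewrite (partition_big G predT) //=; apply: eq_bigr => t _.
    rewrite mulr_suml; apply: eq_bigr => v /eqP ->.
    by rewrite mul1r.
  apply: le_trans (cauchy_schwarz _ _) _.
  - by move=> t; rewrite sumr_ge0.
  - by move=> t; rewrite exprn_ge0.
  rewrite J_sqr ler_wpM2l //.
  (* The phases [th] depend on [x] but not on [t], so they are admissible weights in the moment of
     order [2(l+1)]. *)
  apply: le_trans (weighted_moment_le f l.+1 th_le1).
  by under eq_bigr do rewrite -exprM.
have step4 : `|\sum_x s x| ^+ (k.+1 * l.+1)
    <= #|A|%:R ^+ (k * l.+1)
       * (#|B|%:R ^+ (k.+1 * l) * \sum_v D (G v) ^+ l.+1).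
  have sumD_ge0 : 0 <= \sum_v D (G v) by rewrite sumr_ge0.
  rewrite exprM (le_trans (lerXn2r _ _ _ step1)) ?nnegrE ?exprn_ge0 //.
    by rewrite mulr_ge0 ?exprn_ge0.
  by rewrite exprMn -exprM ler_wpM2l ?exprn_ge0.
have sum_ge0 : 0 <= \sum_v D (G v) ^+ l.+1.
  by apply: sumr_ge0 => v _; rewrite exprn_ge0.
rewrite exprM (le_trans (lerXn2r _ _ _ step4)) ?nnegrE ?exprn_ge0 //.
  by rewrite !mulr_ge0 ?exprn_ge0.
rewrite !exprMn -!exprM mulrA (le_trans (ler_wpM2l _ step3)) //.
  by rewrite mulr_ge0 ?exprn_ge0.
by rewrite le_eqVlt; apply/orP; left; apply/eqP; ring.
Qed.

(** Times [#|F|], each energy is a moment of order [2(n+1)]; for every [t] the power mean over the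
    [J] partial sums costs [J] to the power [2(n+1) - 1]. *)
Lemma energy_partition (A : finType) (f : A -> F) (J : nat) (b : A -> 'I_J) n :
  (energy n.+1 f setT
   <= J ^ (n * 2).+1 * \sum_j energy n.+1 f [set x | b x == j])%N.
Proof.
have F_gt0 : 0 < #|F|%:R :> C by rewrite ltr0n; apply/card_gt0P; exists 0.
rewrite -(ler_nat C) -(ler_pM2l F_gt0) -moment_energy natrM natr_sum natrX.
rewrite mulrCA [X in _ <= _ * X]mulr_sumr.
under [in leRHS]eq_bigr do rewrite -moment_energy.
rewrite exchange_big mulr_sumr; apply: ler_sum => t _.
have -> : \sum_(x in [set: A]) e (t * f x)
    = \sum_j \sum_(x in [set x | b x == j]) e (t * f x).
  rewrite (partition_big b predT) //=; apply: eq_bigr => j _.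
  by apply: eq_bigl => x; rewrite !inE.
pose s j := `|\sum_(x in [set x | b x == j]) e (t * f x)|.
apply: (@le_trans _ _ ((\sum_j s j) ^+ (n * 2).+2)).
  rewrite lerXn2r ?nnegrE //; last exact: ler_norm_sum.
  by apply: sumr_ge0 => j _; exact: normr_ge0.
have := @power_mean _ _ s (n * 2).+1 (fun j => normr_ge0 _).
by rewrite card_ord.
Qed.

End AdditiveCharacter.

(** * Additive energy of factorials *)

(** This is [(X+1)...(X+h)], the polynomial whose value at [m] is the quotient of [(m + h)!] by
    [m!]. *)
Definition rising_factorial (F : nzRingType) (h : nat) : {poly F} :=
  \prod_(0 <= i < h) ('X - (- (i.+1)%:R)%:P).

Lemma size_rising_factorial (F : idomainType) h :
  size (rising_factorial F h) = h.+1.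
Proof. by rewrite size_prod_XsubC size_iota subn0. Qed.

Lemma horner_rising_factorial (F : comNzRingType) m h :
  (m`!)%:R * (rising_factorial F h).[m%:R] = ((m + h)`!)%:R.
Proof.
elim: h => [|h IHh].
  by rewrite /rising_factorial big_geq // hornerC mulr1 addn0.
rewrite /rising_factorial big_nat_recr //= hornerM mulrA IHh.
by rewrite !hornerE opprK -natrD addnS factS natrM mulrC.
Qed.

(** The polynomial of index [h] is monic of degree [h], so the top coefficient of the combination
    must vanish first. *)
Lemma rising_factorial_free (F : idomainType) n (c : nat -> F) :
  \sum_(h < n) c h *: rising_factorial F h = 0 ->
  forall h, (h < n)%N -> c h = 0.
Proof.
elim: n => [//|n IHn]; rewrite big_ord_recr /= => sum0.
have cn0 : c n = 0.
  have := congr1 (fun P : {poly F} => P`_n) sum0.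
  rewrite coefD coef_sum big1 => [|h _]; last first.
    by rewrite coefZ nth_default ?mulr0 // size_rising_factorial.
  rewrite add0r coefZ coef0.
  have /monicP := monic_prod_XsubC (index_iota 0 n) xpredT
    (fun i => - (i.+1)%:R : F).
  rewrite lead_coefE -/(rising_factorial F n) size_rising_factorial /= => ->.
  by rewrite mulr1.
move: sum0; rewrite cn0 scale0r addr0 => /IHn c0 h.
by rewrite ltnS leq_eqVlt => /predU1P[->|/c0].
Qed.

(** The index [b i0] is absent from [a] and occurs in [b] between 1 and [k < p] times, so its
    coefficient is nonzero in characteristic [p], against linear independence. *)
Lemma rising_factorial_sum_neq0 (F : idomainType) (p k n : nat)
    (a b : 'I_k -> 'I_n) (i0 : 'I_k) :
  p \in [pchar F] -> (k < p)%N -> (forall i, a i != b i0) ->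
  \sum_i rising_factorial F (a i) - \sum_i rising_factorial F (b i) != 0.
Proof.
move=> pcharF lt_kp a_neq; apply/eqP => sum0.
pose mult (d : 'I_k -> 'I_n) h : F := #|[pred i | d i == h :> nat]|%:R.
have multE (d : 'I_k -> 'I_n) : \sum_i rising_factorial F (d i)
    = \sum_(h < n) mult d h *: rising_factorial F h.
  rewrite (partition_big d predT) //=; apply: eq_bigr => h _.
  rewrite scaler_nat -sumr_const; apply: eq_big => // i /eqP -> //.
have := @rising_factorial_free F n (fun h => mult a h - mult b h).
have -> : \sum_(h < n) (mult a h - mult b h) *: rising_factorial F h = 0.
  by rewrite -[RHS]sum0 !multE -sumrB; apply: eq_bigr => h _; rewrite scalerBl.
move=> /(_ erefl (b i0) (ltn_ord _)) /eqP.
have -> : mult a (b i0) = 0.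
  rewrite /mult (eq_card0 (A := [pred i | _])) // => i.
  by rewrite !inE; apply: negPf; exact: a_neq.
rewrite sub0r oppr_eq0 /mult -(dvdn_pcharf pcharF) => /dvdn_leq.
have -> : (0 < #|[pred i | b i == b i0 :> nat]|)%N.
  by apply/card_gt0P; exists i0; rewrite inE.
move=> /(_ isT); apply/negP; rewrite -ltnNge (leq_ltn_trans _ lt_kp) //.
by rewrite -[leqRHS]card_ord max_card.
Qed.

(** * Counting roots and solutions in an interval shorter than the characteristic *)

Lemma natr_inj_lt_pchar (F : nzRingType) (p m n : nat) :
  p \in [pchar F] -> (m < p)%N -> (n < p)%N -> m%:R = n%:R :> F -> m = n.
Proof.
move=> pcharF; wlog le_mn : m n / (m <= n)%N => [hw|].
  by case/orP: (leq_total m n) => le_mn ltm ltn eqmn; [|symmetry]; apply: hw.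
move=> ltm ltn eqmn; have : (n - m)%:R == 0 :> F by rewrite natrB // eqmn subrr.
rewrite -(dvdn_pcharf pcharF); have [|ltmn] := leqP n m.
  by move=> ? _; apply/eqP; rewrite eqn_leq le_mn.
rewrite -subn_gt0 in ltmn => /(dvdn_leq ltmn).
by rewrite leqNgt (leq_ltn_trans (leq_subr _ _) ltn).
Qed.

Lemma fact_neq0_lt_pchar (F : idomainType) (p n : nat) :
  p \in [pchar F] -> (n < p)%N -> (n`!)%:R != 0 :> F.
Proof.
move=> pcharF; elim: n => [|n IHn] lt_np; first by rewrite oner_eq0.
rewrite factS natrM mulf_neq0 ?IHn 1?ltnW // -(dvdn_pcharf pcharF).
by rewrite gtnNdvd.
Qed.

(** The integers of the interval are below [p], hence distinct in [F], and a polynomial has fewer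
    roots than its size. *)
Lemma card_roots_interval (F : idomainType) (p K M : nat) (P : {poly F}) :
  p \in [pchar F] -> (K + M < p)%N -> P != 0 ->
  (#|[set m : 'I_M | root P (K.+1 + m)%:R]| < size P)%N.
Proof.
move=> pcharF lt_KMp P_neq0; set S := [set m | _].
have lt_p (m : 'I_M) : (K.+1 + m < p)%N.
  by rewrite (leq_ltn_trans _ lt_KMp) // addSn -addnS leq_add2l.
rewrite cardE -(size_map (fun m : 'I_M => (K.+1 + m)%:R : F)).
apply: max_poly_roots => //.
  by apply/allP => _ /mapP[m mS ->]; move: mS; rewrite mem_enum inE.
rewrite map_inj_in_uniq ?enum_uniq // => m n _ _ /(natr_inj_lt_pchar pcharF).
by move=> /(_ (lt_p m) (lt_p n)) /addnI /val_inj.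
Qed.

(** A covered second tuple is the first one composed with a map of ['I_k] to itself: [#|S| ^ k]
    tuples and [k ^ k] maps. *)
Lemma card_covered_pairs (A : finType) (S : {set A}) (k : nat) :
  (#|[set w : {ffun 'I_k -> A} * {ffun 'I_k -> A} |
      [&& [forall i, w.1 i \in S], [forall i, w.2 i \in S]
        & [forall i, exists j, w.1 j == w.2 i]]]| <= #|S| ^ k * k ^ k)%N.
Proof.
pose D := setX [set u : {ffun 'I_k -> A} | [forall i, u i \in S]]
  [set: {ffun 'I_k -> 'I_k}].
pose g (q : {ffun 'I_k -> A} * {ffun 'I_k -> 'I_k}) :=
  (q.1, [ffun i => q.1 (q.2 i)]).
apply: (@leq_trans #|g @: D|); last first.
  apply: leq_trans (leq_imset_card _ _) _.
  rewrite cardsX cardsT card_ffun card_ord leq_mul2r; apply/orP; right.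
  rewrite -[X in (_ <= _ ^ X)%N]card_ord -card_ffun_on subset_leq_card //.
  apply/subsetP => u; rewrite inE => /forallP uS.
  by apply/ffun_onP.
apply/subset_leq_card/subsetP => -[u v]; rewrite inE /=.
move=> /and3P[uS _ /forallP uv].
pose s := [ffun i => xchoose (existsP (uv i))].
apply/imsetP; exists (u, s); first by rewrite !inE uS.
congr pair; apply/ffunP => i; rewrite !ffunE /=.
by apply/esym/eqP; exact: (xchooseP (existsP (uv i))).
Qed.

(** The shift at the base entry is 0; the factor [H.+1] saved here pays for the roots of the
    polynomial. *)
Lemma card_ffun_vanishing_at (I : finType) (H : nat) (s : I) :
  #|[set h : {ffun I -> 'I_H.+1} | h s == ord0]| = (H.+1 ^ #|I|.-1)%N.
Proof.
rewrite -[X in (X ^ _)%N]card_ord -(cardC1 s) -(card_pffun_on (ord0 : 'I_H.+1)).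
apply: eq_card => h; rewrite inE.
apply/eqP/pffun_onP => [hs0 | [/subsetP hD _]].
  split=> //; apply/subsetP => x; rewrite !inE.
  by apply: contraNneq => ->; apply/eqP.
by apply/eqP; apply: contraT => /hD; rewrite !inE eqxx.
Qed.

Section FactorialEnergy.

Variables (F : finFieldType) (p k K M H : nat).
Hypothesis pcharF : p \in [pchar F].
Hypotheses (lt_kp : (k < p)%N) (lt_KMp : (K + M < p)%N).

Let f (m : 'I_M) : F := ((K.+1 + m)`!)%:R.
Let entry (w : {ffun 'I_k -> 'I_M} * {ffun 'I_k -> 'I_M}) (x : 'I_k + 'I_k) :
    'I_M :=
  match x with inl i => w.1 i | inr i => w.2 i end.

(** Take a least entry as base. There are [2k] positions for it and [H.+1 ^ (2k-1)] shift vectors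
    vanishing there; for each choice the base value is a root of a nonzero polynomial of degree at
    most [H]. *)
Lemma card_uncovered_solutions :
  (#|[set w : {ffun 'I_k -> 'I_M} * {ffun 'I_k -> 'I_M} |
      [&& [forall x, forall y, entry w x < entry w y + H.+1],
          [exists i, forall j, w.1 j != w.2 i]
        & (\sum_i f (w.1 i) == \sum_i f (w.2 i))%R]]|
   <= k.*2 * H.+1 ^ k.*2)%N.
Proof.
set N := [set w | _].
(* q = (s, h): the entries of w are those of the base entry s shifted by h. *)
pose shape (q : ('I_k + 'I_k) * {ffun 'I_k + 'I_k -> 'I_H.+1}) :=
  [set w in N | [forall x, entry w x == (entry w q.1 + q.2 x)%N :> nat]].
have card_shape q : (#|shape q| <= H.+1)%N.
  case: q => s h; have [-> | [w0]] := set_0Vmem (shape (s, h)).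
    by rewrite cards0.
  rewrite !inE /=.
  (* One member [w0] of the shape suffices: its uncovered entry [i0] has a shift different from all
     shifts on the left, which makes [P] nonzero for the whole shape. *)
  move=> /andP[/and3P[_ /existsP[i0 /forallP uncov] _] /forallP w0h].
  pose P := \sum_i rising_factorial F (h (inl i))
    - \sum_i rising_factorial F (h (inr i)).
  have P_neq0 : P != 0.
    apply: (rising_factorial_sum_neq0 (i0 := i0) pcharF lt_kp) => i.
    apply: contra (uncov i) => /eqP hi; apply/eqP/val_inj.
    have /eqP := w0h (inl i); have /eqP := w0h (inr i0); rewrite /= => -> ->.
    by rewrite hi.
  have size_P : (size P <= H.+1)%N.
    have size_sum_le (d : 'I_k -> 'I_H.+1) :
        (size (\sum_i rising_factorial F (d i))%R <= H.+1)%N.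
      apply: leq_trans (size_sum _ _ _) _; apply/bigmax_leqP => i _.
      by rewrite size_rising_factorial.
    apply: leq_trans (size_polyD _ _) _; rewrite size_polyN geq_max.
    by rewrite (size_sum_le (fun i => h (inl i)))
      (size_sum_le (fun i => h (inr i))).
  apply: leq_trans size_P; apply: ltnW.
  apply: leq_ltn_trans (card_roots_interval pcharF lt_KMp P_neq0).
  (* Once the shape is fixed, [w] is determined by its base entry, so it is enough to count base
     values. *)
  rewrite -(card_in_imset (f := fun w => entry w s) (D := shape (s, h)));
    last first.
    move=> w w'; rewrite !inE => /andP[_ /forallP wh] /andP[_ /forallP w'h] eqs.
    have eqw x : entry w x = entry w' x.
      by apply: val_inj; rewrite /= (eqP (wh x)) (eqP (w'h x)) eqs.
    case: w w' eqw {wh w'h eqs} => [u v] [u' v'] eqw.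
    by congr pair; apply/ffunP => i;
      [exact: (eqw (inl i)) | exact: (eqw (inr i))].
  apply/subset_leq_card/subsetP => m /imsetP[w]; rewrite !inE.
  move=> /andP[/and3P[_ _ /eqP sum_eq] /forallP wh] ->.
  have fE x : f (entry w x) = ((K.+1 + entry w s)`!)%:R
      * (rising_factorial F (h x)).[(K.+1 + entry w s)%:R].
    by rewrite horner_rising_factorial /f (eqP (wh x)) addnA.
  have fact_neq0 : ((K.+1 + entry w s)`!)%:R != 0 :> F.
    rewrite (fact_neq0_lt_pchar pcharF) // (leq_ltn_trans _ lt_KMp) //.
    by rewrite addSn -addnS leq_add2l.
  rewrite /root; apply/eqP/(mulfI fact_neq0); rewrite mulr0.
  rewrite hornerD hornerN !horner_sum mulrBr !mulr_sumr.
  under eq_bigr do rewrite -fE; under [X in _ - X]eq_bigr do rewrite -fE.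
  by apply/eqP; rewrite subr_eq0 sum_eq.
have cover w : w \in N ->
    (1 <= \sum_(q : ('I_k + 'I_k) * {ffun 'I_k + 'I_k -> 'I_H.+1}
               | q.2 q.1 == ord0) (w \in shape q))%N.
  move=> wN; have := wN; rewrite inE => /and3P[/forallP close /existsP[i0 _] _].
  (* The uncovered index [i0] also shows that the index type is inhabited, so a least entry
     exists. *)
  case: (@arg_minnP _ (inr i0 : 'I_k + 'I_k) xpredT
    (fun x => val (entry w x)) isT) => s _ min_s.
  pose h := [ffun x => inord (entry w x - entry w s) : 'I_H.+1].
  have hE x : h x = (entry w x - entry w s)%N :> nat.
    rewrite ffunE inordK //.
    by have /forallP/(_ s) := close x; have := min_s x isT; lia.
  rewrite (bigD1 (s, h)) /=; last by apply/eqP/val_inj; rewrite /= hE subnn.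
  suff -> : w \in shape (s, h) by [].
  rewrite inE wN; apply/forallP => x /=; rewrite hE.
  by have /= := min_s x isT; lia.
have -> : (k.*2 * H.+1 ^ k.*2)%N
    = (\sum_(q : ('I_k + 'I_k) * {ffun 'I_k + 'I_k -> 'I_H.+1}
              | q.2 q.1 == ord0) H.+1)%N.
  rewrite -(pair_big_dep xpredT
    (fun s (h : {ffun 'I_k + 'I_k -> 'I_H.+1}) => h s == ord0)
    (fun _ _ => H.+1)) /=.
  have cardI : #|{: 'I_k + 'I_k}| = k.*2 by rewrite card_sum card_ord addnn.
  rewrite -[X in (X * _)%N]cardI -sum_nat_const; apply: eq_bigr => s _.
  rewrite sum_nat_const.
  have := card_ffun_vanishing_at H s; rewrite cardsE => ->.
  by rewrite -expnSr prednK cardI // -cardI; apply/card_gt0P; exists s.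
apply: (@leq_trans
  (\sum_(q : ('I_k + 'I_k) * {ffun 'I_k + 'I_k -> 'I_H.+1}
         | q.2 q.1 == ord0) #|shape q|)); last exact: leq_sum.
rewrite -[leqLHS]sum1_card.
(* Double counting: every element of [N] lies in at least one shape. *)
apply: leq_trans (leq_sum _ cover) _.
rewrite exchange_big /=; apply: leq_sum => q _.
rewrite -sum1_card [leqRHS]big_mkcond [leqLHS]big_mkcond /=.
by apply: leq_sum => w _; case: (w \in N); case: (w \in shape q).
Qed.

End FactorialEnergy.

(** Covered solutions are bounded block by block. Uncovered ones are bounded once for all blocks
    together, since their entries are within [H] of each other and a solution determines its
    block. *)
Lemma energy_factorial_short (F : finFieldType) (p k K M H : nat)
    (f : 'I_M -> F := fun m => ((K.+1 + m)`!)%:R)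
    (b : 'I_M -> 'I_(M %/ H.+1).+1 := fun m => inord (m %/ H.+1)) :
  p \in [pchar F] -> (k.+1 < p)%N -> (K + M < p)%N ->
  (\sum_j energy k.+1 f [set m | b m == j]
   <= (M %/ H.+1).+1 * (H.+1 ^ k.+1 * k.+1 ^ k.+1)
      + k.+1.*2 * H.+1 ^ k.+1.*2)%N.
Proof.
move=> pcharF lt_kp lt_KMp.
have bE m : b m = (m %/ H.+1)%N :> nat.
  by rewrite inordK // ltnS leq_div2r // ltnW.
have card_block j : (#|[set m | b m == j]| <= H.+1)%N.
  rewrite -[leqRHS]card_ord.
  (* Inside a block the quotient is fixed, so the remainder modulo [H.+1] identifies the element. *)
  rewrite -(card_in_imset (f := fun m : 'I_M => inord (m %% H.+1) : 'I_H.+1)).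
    exact: max_card.
  move=> m n; rewrite !inE => /eqP bm /eqP bn /(congr1 val) /=.
  rewrite !inordK ?ltn_mod // => eq_mod; apply: val_inj => /=.
  by rewrite (divn_eq m H.+1) (divn_eq n H.+1) eq_mod -!bE bm bn.
pose block j := [set m | b m == j].
pose sol j := [set w : {ffun 'I_k.+1 -> 'I_M} * {ffun 'I_k.+1 -> 'I_M} |
  [&& [forall i, w.1 i \in block j], [forall i, w.2 i \in block j]
    & (\sum_i f (w.1 i) == \sum_i f (w.2 i))%R]].
pose cov := [set w : {ffun 'I_k.+1 -> 'I_M} * {ffun 'I_k.+1 -> 'I_M} |
  [forall i, exists j, w.1 j == w.2 i]].
have -> : (\sum_j energy k.+1 f [set m | b m == j]
    = \sum_j #|sol j :&: cov| + \sum_j #|sol j :\: cov|)%N.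
  by rewrite -big_split /=; apply: eq_bigr => j _; rewrite cardsID.
apply: leq_add.
  rewrite -[X in (_ <= X * _)%N]card_ord -sum_nat_const; apply: leq_sum => j _.
  apply: (@leq_trans (#|block j| ^ k.+1 * k.+1 ^ k.+1)).
    apply: leq_trans (card_covered_pairs _ _); apply: subset_leq_card.
    by apply/subsetP => w; rewrite !inE => /andP[/and3P[-> -> _] ->].
  by rewrite leq_mul2r leq_exp2r ?card_block ?orbT.
apply: leq_trans (card_uncovered_solutions H pcharF lt_kp lt_KMp).
set N := [set w | _].
rewrite (eq_bigr (fun j => \sum_w (w \in sol j :\: cov))%N); last first.
  move=> j _; rewrite -sum1_card [LHS]big_mkcond.
  by apply: eq_bigr => w _; case: (w \in _).
rewrite exchange_big -[leqRHS]sum1_card [leqRHS]big_mkcond.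
apply: leq_sum => w _ /=.
(* The first entry of [w] names the only block that can contain it, so each [w] is counted at most
   once. *)
have sol_sub j : w \in sol j :\: cov -> (j == b (w.1 ord0)) && (w \in N).
  rewrite !inE => /andP[uncov /and3P[/forallP w1 /forallP w2 eq_sum]].
  have w1j i : b (w.1 i) = j by have := w1 i; rewrite inE => /eqP.
  have w2j i : b (w.2 i) = j by have := w2 i; rewrite inE => /eqP.
  rewrite w1j eqxx /= eq_sum andbT; apply/andP; split.
    have close (m n : 'I_M) : b m = j -> b n = j -> (m < n + H.+1)%N.
      move=> /(congr1 val) + /(congr1 val); rewrite /= !bE => bm bn.
      rewrite (divn_eq m H.+1) (divn_eq n H.+1) bm bn -addnA ltn_add2l.
      by rewrite ltn_addl // ltn_mod.
    by apply/forallP => -[i|i]; apply/forallP => -[i'|i']; apply: close.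
  have [i /existsPn unc] := forallPn uncov.
  by apply/existsP; exists i; apply/forallP => i'; exact: unc.
apply: (@leq_trans
  (\sum_(j < (M %/ H.+1).+1) ((j == b (w.1 ord0)) && (w \in N)))%N).
  by apply: leq_sum => j _; case: (w \in _) (sol_sub j) => // ->.
case: (w \in N); last by rewrite big1 // => j _; rewrite andbF.
by rewrite (bigD1 (b (w.1 ord0))) //= eqxx big1 // => j /negPf ->.
Qed.

(** * Choice of the block length and the energy bound *)

Lemma energy_le_card (F : finFieldType) (A : finType) n (f : A -> F) S :
  (energy n f S <= #|A| ^ (n * 2))%N.
Proof.
apply: leq_trans (max_card _) _.
by rewrite card_prod card_ffun card_ord muln2 -addnn expnD.
Qed.

(** The condition [h ^ k.+2 <= M] makes the uncovered term no larger in order than the covered one.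
    The saving is kept as a factor [h ^ k.+1] on the left, which avoids fractional exponents. *)
Lemma block_optimisation (E J h M k : nat) :
  (0 < h)%N -> (J * h <= 2 * M)%N -> (h ^ k.+2 <= M)%N ->
  (E <= J ^ (k * 2).+1
    * (J * (h ^ k.+1 * k.+1 ^ k.+1) + k.+1.*2 * h ^ k.+1.*2))%N ->
  (E * h ^ k.+1 <= 4 ^ k.+1 * (k.+1 ^ k.+1 + k.+1) * M ^ (k.+1 * 2))%N.
Proof.
move=> h_gt0 le_Jh le_hM le_E.
(* The left side now carries [h ^ (2k+2)]: [2k+1] factors pair with the power of [J], the last one
   with the bracket. *)
rewrite -(leq_pmul2r (m := h ^ k.+1)) ?expn_gt0 ?h_gt0 //.
set c := (k.+1 ^ k.+1)%N; set d := (h ^ k.+1)%N.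
have dd : (h ^ k.+1.*2 = d * d)%N by rewrite -addnn expnD.
have d_h : (d * h <= M)%N by rewrite mulnC -expnS.
have le1 : (J ^ (k * 2).+1 * h ^ (k * 2).+1 <= (2 * M) ^ (k * 2).+1)%N.
  by rewrite -expnMn leq_exp2r.
have le2 : ((J * (d * c) + k.+1.*2 * (d * d)) * h <= 2 * M * (c + k.+1) * d)%N.
  have := leq_mul le_Jh (leqnn (d * c)).
  have := leq_mul (leqnn (k.+1.*2 * d)) d_h.
  move: (k.+1) => k1; rewrite -mul2n; lia.
have -> : (4 ^ k.+1 * (c + k.+1) * M ^ (k.+1 * 2) * d
    = (2 * M) ^ (k * 2).+1 * (2 * M * (c + k.+1) * d))%N.
  have -> : (4 ^ k.+1 = 2 ^ (k * 2).+1 * 2)%N.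
    by rewrite -expnSr -[4%N]/(2 ^ 2)%N -expnM mulnC mulSn.
  rewrite -[(k.+1 * 2)%N]/(k * 2).+2 (expnS M) expnMn.
  by move: (2 ^ _)%N (M ^ _)%N => x y; ring.
apply: leq_trans (leq_mul le1 le2); rewrite -mulnA.
have hd : (h ^ k.+1 * d = h ^ (k * 2).+1 * h)%N.
  by rewrite -/d -dd -expnSr -muln2 mulSn.
rewrite [X in (_ * X <= _)%N]hd; apply: leq_trans (leq_mul le_E (leqnn _)) _.
by rewrite -!mulnA leq_mul2l -/c -/d dd [X in _ || (X <= _)%N]mulnCA leqnn orbT.
Qed.

Lemma energy_factorial (C : numClosedFieldType) (F : finFieldType) (e : F -> C)
    (p k K M H : nat) (f : 'I_M -> F := fun m => ((K.+1 + m)`!)%:R) :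
  {morph e : x y / x + y >-> x * y} -> (forall x, `|e x| = 1) ->
  (exists x, e x != 1) -> p \in [pchar F] -> (K + M < p)%N ->
  (H.+1 ^ k.+2 <= M)%N ->
  (energy k.+1 f setT * H.+1 ^ k.+1
   <= 4 ^ k.+1 * (k.+1 ^ k.+1 + k.+1) * M ^ (k.+1 * 2))%N.
Proof.
move=> eD norm_e e_nontrivial pcharF lt_KMp le_HM.
have le_H : (H.+1 <= M)%N.
  by apply: leq_trans le_HM; rewrite expnS leq_pmulr ?expn_gt0.
(* If p <= k + 1 then M < k + 1 and the trivial bound M^(2k+2) is enough. *)
have [le_pk | lt_kp] := leqP p k.+1.
  apply: leq_trans (leq_mul (energy_le_card _ _ _) (leqnn _)) _.
  rewrite card_ord mulnC leq_mul2r; apply/orP; right.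
  apply: (@leq_trans (k.+1 ^ k.+1)).
    by rewrite leq_exp2r //; move: lt_KMp le_pk le_H; lia.
  by rewrite -[leqLHS]mul1n leq_mul ?leq_addr // expn_gt0.
apply: (block_optimisation (J := (M %/ H.+1).+1)) => //.
  (* [J * H.+1 <= M + H.+1 <= 2 * M], by [le_H]. *)
  by rewrite mulSn; have := leq_trunc_div M H.+1; lia.
apply: leq_trans (energy_partition eD norm_e e_nontrivial f
  (fun m => inord (m %/ H.+1) : 'I_(M %/ H.+1).+1) k) _.
by rewrite leq_mul2l (energy_factorial_short H pcharF lt_kp lt_KMp) orbT.
Qed.

(** * The exponential sum *)

From mathcomp Require Import all_classical all_reals all_analysis.
From mathcomp Require Import complex.
Import Order.TTheory GRing.Theory Num.Theory.
Local Open Scope complex_scope.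

(** * The complex exponential as a character of the prime field *)

Lemma cexpD (R : realType) : {morph @cexp R : z w / z + w >-> z * w}.
Proof.
move=> [a b] [c d]; rewrite /cexp /= expRD cosD sinD.
by apply/eqP; rewrite eq_complex /=; apply/andP; split; apply/eqP; ring.
Qed.

Lemma cexp0 (R : realType) : cexp (0 : R[i]) = 1.
Proof. by rewrite /cexp /= expR0 cos0 sin0 mul1r. Qed.

Lemma cexpMn (R : realType) (z : R[i]) n : cexp (z *+ n) = cexp z ^+ n.
Proof.
by elim: n => [|n IHn]; rewrite ?mulr0n ?cexp0 // mulrS cexpD IHn exprS.
Qed.

Lemma cexpMz_eq1 (R : realType) (z : R[i]) (n : int) :
  cexp z = 1 -> cexp (z *~ n) = 1.
Proof.
have pos m : cexp z = 1 -> cexp (z *+ m) = 1.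
  by move=> ez; rewrite cexpMn ez expr1n.
case: n => m ez; first exact: pos.
rewrite NegzE mulrNz -pmulrn; have := cexpD (- (z *+ m.+1)) (z *+ m.+1).
by rewrite addNr cexp0 (pos m.+1 ez) mulr1.
Qed.

Lemma cexp_realMi (R : realType) (t : R) : cexp (t%:C * 'i%C) = cos t +i* sin t.
Proof.
by rewrite /cexp /= !(mulr0, mul0r, mulr1, oppr0, addr0) expR0 mul1r.
Qed.

Lemma real_complex_double (R : realType) (x : R) : 2 * x%:C = (x *+ 2)%:C.
Proof. by rewrite rmorphMn /= mulr_natl. Qed.

Lemma cexp_2pi (R : realType) : cexp (2 * (pi : R)%:C * 'i%C) = 1.
Proof.
rewrite real_complex_double.
by rewrite cexp_realMi cos2pi sin2pi.
Qed.

(** For [p > 2] the angle lies strictly between 0 and pi, so its sine is positive. *)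
Lemma cexp_2pi_div_neq1 (R : realType) (p : nat) :
  (2 < p)%N -> cexp (2 * (pi : R)%:C * 'i%C / p%:R) != 1.
Proof.
move=> p_gt2; have p_gt0 : 0 < p%:R :> R by rewrite ltr0n; lia.
have -> : 2 * (pi : R)%:C * 'i%C / p%:R = ((pi *+ 2) / p%:R)%:C * 'i%C.
  rewrite real_complex_double; move: (_ *+ 2) => x.
  by rewrite rmorphM fmorphV rmorph_nat /= mulrAC.
apply/eqP; rewrite cexp_realMi => /(congr1 (@complex.Im R)) /= /eqP; apply/negP.
have bounds (x : R) : 0 < x -> 0 < x *+ 2 / p%:R < x.
  move=> x_gt0; rewrite divr_gt0 ?pmulrn_rgt0 //= ?ltr0n; last by lia.
  by rewrite ltr_pdivrMr // -[x *+ 2]mulr_natr ltr_pM2l ?ltr_nat.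
by rewrite gt_eqF // sin_gt0_pi // bounds // pi_gt0.
Qed.

(** With the Bezout relation [u * a + v * p = 1], [t / p] is [u] times [t * a / p] plus [v] times
    [t]; if [t * a / p] had exponential 1, so would [t / p]. *)
Lemma cexp_root_of_unity (R : realType) (t : R[i]) (p : nat) (a : int) :
  (0 < p)%N -> coprimez a p%:Z -> cexp t = 1 -> cexp (t / p%:R) != 1 ->
  cexp (t * a%:~R / p%:R) ^+ p = 1 /\ cexp (t * a%:~R / p%:R) != 1.
Proof.
move=> p_gt0 /coprimezP[[u v] /= uv] t1 tp_neq1.
have p_neq0 : p%:R != 0 :> R[i] by rewrite pnatr_eq0 -lt0n.
split; first by rewrite -cexpMn -[_ *+ p]mulr_natr divfK // mulrzr cexpMz_eq1.
apply: contra_neq tp_neq1 => /(cexpMz_eq1 u) ta1.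
have uvC : u%:~R * a%:~R + v%:~R * p%:R = 1 :> R[i].
  by rewrite -[p%:R]/(p%:~R) -!intrM -intrD uv.
have -> : t / p%:R = t * a%:~R / p%:R *~ u + t *~ v.
  transitivity (t * (u%:~R * a%:~R + v%:~R * p%:R) / p%:R).
    by rewrite uvC mulr1.
  rewrite -[t * a%:~R / p%:R *~ u]mulrzr -[t *~ v]mulrzr.
  rewrite mulrDr mulrDl !mulrA mulfK //.
  by rewrite [t * u%:~R * a%:~R]mulrAC [t * a%:~R * u%:~R / _]mulrAC.
by rewrite cexpD ta1 cexpMz_eq1 ?mulr1.
Qed.

(** The exponent missing on the right is [(k+1)/(k+2)], and [M] to that power is at most
    [(2h) ^ (k+1)] by hypothesis. *)
Lemma powR_block (R : realType) (M h k l : nat) :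
  (0 < M)%N -> (M <= (2 * h) ^ k.+2)%N ->
  M%:R ^+ (k.+1 * l.+1 * 2)
  <= (M%:R `^ (1 - 1 / (2 * l.+1%:R * (k.+1%:R + 1)))) ^+ (k.+1 * l.+1 * 2)
     * (2 * h)%:R ^+ k.+1 :> R.
Proof.
move=> M_gt0 le_M.
have M_neq0 : M%:R != 0 :> R by rewrite pnatr_eq0 -lt0n.
have M_ge0 : 0 <= M%:R :> R by rewrite ler0n.
set al := 1 - _.
rewrite -!powR_mulrn ?powR_ge0 ?ler0n // -powRrM.
have expE : (k.+1 * l.+1 * 2)%:R
    = al * (k.+1 * l.+1 * 2)%:R + (k.+2%:R)^-1 * k.+1%:R :> R.
  rewrite /al !natrM -[k.+2%:R]natr1.
  have : 0 < k.+1%:R :> R by rewrite ltr0n.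
  have : 0 < l.+1%:R :> R by rewrite ltr0n.
  move: (k.+1%:R) (l.+1%:R) => x y y_gt0 x_gt0; field.
  by rewrite !gt_eqF ?addr_gt0.
rewrite [in leLHS]expE powRD ?M_neq0 ?implybT // ler_wpM2l ?powR_ge0 //.
rewrite powRrM ge0_ler_powR ?nnegrE ?ler0n ?powR_ge0 //.
have -> : (2 * h)%:R = ((2 * h)%:R ^+ k.+2) `^ (k.+2%:R)^-1 :> R.
  by rewrite -powR_mulrn ?ler0n // -powRrM divff ?powRr1 ?pnatr_eq0.
by rewrite ge0_ler_powR ?nnegrE ?invr_ge0 ?ler0n ?exprn_ge0 // -natrX ler_nat.
Qed.

(** Since [z ^+ p = 1], the power [z ^+ n] depends only on [n] modulo [p]; and [z] has modulus 1
    because its norm is a nonnegative [p]-th root of 1. *)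
Lemma root_of_unity_character (C : numClosedFieldType) (p : nat) (z : C) :
  prime p -> z ^+ p = 1 -> z != 1 ->
  exists e : 'F_p -> C,
  [/\ {morph e : x y / x + y >-> x * y}, forall x, `|e x| = 1,
      exists x, e x != 1 & forall n, e n%:R = z ^+ n].
Proof.
move=> p_pr zp z_neq1; pose e (x : 'F_p) := z ^+ x; exists e.
have e_nat n : e n%:R = z ^+ n by rewrite /e val_Fp_nat // expr_mod.
have norm_z : `|z| = 1.
  by apply/eqP; rewrite -(pexpr_eq1 (prime_gt0 p_pr)) // -normrX zp normr1.
split=> //.
- by move=> x y; rewrite -[x]natr_Zp -[y]natr_Zp -natrD !e_nat exprD.
- by move=> x; rewrite /e normrX norm_z expr1n.
by exists 1; rewrite -[1]/(1%:R) e_nat.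
Qed.

Lemma W_eq_character_sum (R : realType) (p : nat) (a : int) (K M L N : nat)
    (e : 'F_p -> R[i]) :
  (forall n, e n%:R = cexp (2 * (pi : R)%:C * 'i%C * a%:~R / p%:R) ^+ n) ->
  W R p a K M L N
  = \sum_(m < M) \sum_(n < N) e (((K.+1 + m)`!)%:R * ((L.+1 + n)`!)%:R).
Proof.
move=> e_nat; rewrite /W -[K.+1]add0n big_addn subSS addKn big_mkord.
apply: eq_bigr => m _; rewrite -[L.+1]add0n big_addn subSS addKn big_mkord.
apply: eq_bigr => n _; rewrite -natrM e_nat -cexpMn; congr cexp.
rewrite !add0n [(m + _)%N]addnC [(n + _)%N]addnC.
move: (2 * _%:C * _) (_`!) (_`!) => t x y.
rewrite -[_ *+ (y * x)]mulr_natr natrM mulrA.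
by rewrite [t * a%:~R / _ * _]mulrAC [RHS]mulrAC.
Qed.

(** [h.+1] is the integer part of the root, and [h.+2 <= 2 * h.+1]. *)
Lemma floor_root (k M : nat) :
  (0 < M)%N -> exists h, (h.+1 ^ k.+1 <= M)%N /\ (M <= (2 * h.+1) ^ k.+1)%N.
Proof.
move=> M_gt0; pose P h := (h.+1 ^ k.+1 <= M)%N.
have exP : exists h, P h by exists 0; rewrite /P exp1n.
have ubP h : P h -> (h <= M)%N.
  move=> Ph; apply: leq_trans Ph; rewrite expnS; apply: ltnW.
  by rewrite leq_pmulr // expn_gt0.
have [h Ph max_h] := ex_maxnP exP ubP; exists h; split=> //.
have : ~~ P h.+1 by apply: contraTN isT => /max_h; rewrite ltnn.
rewrite /P -ltnNge => /ltnW/leq_trans; apply.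
by rewrite leq_exp2r // mul2n -addnn addSnnS leq_addl.
Qed.

(** * Assembly of the bound *)

Theorem theorem4 (R : realType) (k l : nat) (hk : (1 <= k)%N) (hl : (1 <= l)%N) :
  exists2 c : R, 0 < c &
    forall p K M L N : nat,
      prime p -> odd p ->
      (K < K + M)%N -> (K + M < p)%N ->
      (L < L + N)%N -> (L + N < p)%N ->
      forall a : int, coprimez a p%:Z ->
        `| W R p a K M L N | <=
          (c * (M%:R `^ (1 - 1 / (2 * l%:R * (k%:R + 1))))
             * (N%:R `^ (1 - 1 / (2 * k%:R * (l%:R + 1))))
             * (p%:R `^ (1 / (2 * k%:R * l%:R))))%:C.
Proof.
case: k hk => // k _; case: l hl => // l _.
(* [A] is the constant of the energy bound; the powers of 2 in [c] come from rounding the two block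
   lengths. *)
pose A n := (4 ^ n.+1 * (n.+1 ^ n.+1 + n.+1))%N.
pose c := (A k * A l * 2 ^ k.+1 * 2 ^ l.+1)%N.
have c_gt0 : (0 < c)%N by rewrite /c /A !(muln_gt0, expn_gt0, addn_gt0, orbT).
exists c%:R; first by rewrite ltr0n.
move=> p K M L N p_pr odd_p lt_K lt_KM lt_L lt_LN a co_ap.
have M_gt0 : (0 < M)%N by lia.
have N_gt0 : (0 < N)%N by lia.
have [z_p z_neq1] := cexp_root_of_unity (prime_gt0 p_pr) co_ap (cexp_2pi R)
  (cexp_2pi_div_neq1 R (odd_prime_gt2 odd_p p_pr)).
have [e [eD norm_e e_nontriv e_nat]] := root_of_unity_character p_pr z_p z_neq1.
rewrite (W_eq_character_sum _ _ _ _ e_nat).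
set f := fun m : 'I_M => ((K.+1 + m)`!)%:R : 'F_p.
set g := fun n : 'I_N => ((L.+1 + n)`!)%:R : 'F_p.
have [h1 [le_h1 ge_h1]] := floor_root k.+1 M_gt0.
have [h2 [le_h2 ge_h2]] := floor_root l.+1 N_gt0.
have pcharF := pchar_Fp p_pr.
have Ef := energy_factorial eD norm_e e_nontriv pcharF lt_KM le_h1.
have Eg := energy_factorial eD norm_e e_nontriv pcharF lt_LN le_h2.
(* The exponents are passed as [l k], so that [f] gets the energy of order [k.+1] and [g] that of
   order [l.+1]. *)
have bound := bilinear_bound eD norm_e e_nontriv f g l k.
rewrite card_Fp // !card_ord in bound.
set S := \sum_(m < M) _.
have [w w_ge0 wE] : exists2 w : R, 0 <= w & `|S| = w%:C.
  by rewrite normc_def; eexists; last reflexivity; exact: sqrtr_ge0.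
rewrite wE lecR.
set n := (l.+1 * k.+1 * 2)%N in bound.
set E1 := energy k.+1 _ _ in Ef bound; set E2 := energy l.+1 _ _ in Eg bound.
(* The combined saving of both energy bounds; it is cancelled at the end against the block lengths
   from [powR_block]. *)
pose D := (h1.+1 ^ k.+1 * h2.+1 ^ l.+1)%N.
have le_nat : (p * M ^ (l * k.+1 * 2) * N ^ (l.+1 * k * 2) * E1 * E2 * D
    <= A k * A l * p * (M ^ n * N ^ n))%N.
  have -> : (M ^ n = M ^ (l * k.+1 * 2) * M ^ (k.+1 * 2))%N.
    by rewrite -expnD -mulnDl -mulSnr.
  have -> : (N ^ n = N ^ (l.+1 * k * 2) * N ^ (l.+1 * 2))%N.
    by rewrite -expnD -mulnDl -mulnSr.
  move: (leq_mul Ef Eg); rewrite /D -/(A k) -/(A l).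
  move: (M ^ _)%N (M ^ _)%N (N ^ _)%N (N ^ _)%N (h1.+1 ^ _)%N (h2.+1 ^ _)%N.
  move=> m m' n1 n1' d d' le_EE.
  rewrite (_ : (_ * (d * d') = p * m * n1 * (E1 * d * (E2 * d')))%N); last by ring.
  rewrite (_ : (A k * A l * p * (m * m' * (n1 * n1'))
    = p * m * n1 * (A k * m' * (A l * n1')))%N); last by ring.
  by rewrite leq_mul2l le_EE orbT.
have le_w : w ^+ n * D%:R <= (A k * A l)%:R * p%:R * (M%:R ^+ n * N%:R ^+ n).
  rewrite -!natrX -!natrM; apply: le_trans (_ : _ <= _%:R) _; last first.
    by rewrite ler_nat; exact: le_nat.
  rewrite [leRHS]natrM ler_wpM2r ?ler0n // -lecR rmorphXn rmorph_nat /= -wE.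
  by rewrite !natrM !natrX.
set mu := M%:R `^ _; set nu := N%:R `^ _; set pp := p%:R `^ _.
have mu_ge0 : 0 <= mu by exact: powR_ge0.
have nu_ge0 : 0 <= nu by exact: powR_ge0.
have pp_n : pp ^+ n = p%:R.
  rewrite -powR_mulrn ?powR_ge0 // -powRrM (_ : _ * _ = 1) ?powRr1 ?ler0n //.
  rewrite /n !natrM; have : k.+1%:R != 0 :> R by rewrite pnatr_eq0.
  have : l.+1%:R != 0 :> R by rewrite pnatr_eq0.
  move: (k.+1%:R) (l.+1%:R) => x y y_neq0 x_neq0; field.
  by rewrite y_neq0 x_neq0.
have le_M : M%:R ^+ n <= mu ^+ n * (2 * h1.+1)%:R ^+ k.+1 :> R.
  by rewrite /n [(l.+1 * _)%N]mulnC powR_block.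
have le_N : N%:R ^+ n <= nu ^+ n * (2 * h2.+1)%:R ^+ l.+1 :> R.
  exact: powR_block.
have D_gt0 : 0 < D%:R :> R by rewrite ltr0n muln_gt0 !expn_gt0.
have n_gt0 : (0 < n)%N by [].
(* Both sides are nonnegative, so [n]-th powers can be compared, with [n = 2(k+1)(l+1)]. *)
rewrite -(ler_pXn2r n_gt0) ?nnegrE ?mulr_ge0 ?powR_ge0 ?ler0n //.
rewrite !exprMn pp_n -(ler_pM2r D_gt0) (le_trans le_w) //.
apply: (@le_trans _ _ ((A k * A l)%:R * p%:R
    * ((mu ^+ n * (2 * h1.+1)%:R ^+ k.+1) * (nu ^+ n * (2 * h2.+1)%:R ^+ l.+1)))).
  by rewrite ler_wpM2l ?mulr_ge0 ?ler0n // ler_pM ?exprn_ge0 ?ler0n.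
(* As [c >= 1], taking [c] itself instead of its [n]-th root is enough. *)
have le_c : c%:R <= c%:R ^+ n :> R.
  by rewrite -natrX ler_nat -[leqLHS]expn1 leq_pexp2l.
have -> : (A k * A l)%:R * p%:R
    * ((mu ^+ n * (2 * h1.+1)%:R ^+ k.+1) * (nu ^+ n * (2 * h2.+1)%:R ^+ l.+1))
    = c%:R * (mu ^+ n * (nu ^+ n * (p%:R * D%:R))) :> R.
  rewrite /c /D !natrM !exprMn !natrX.
  move: (mu ^+ n) (nu ^+ n) (h1.+1%:R ^+ _) (h2.+1%:R ^+ _) => x y d d'.
  by ring.
have assoc (x y z t u : R) : x * y * z * t * u = x * (y * (z * (t * u))).
  by rewrite !mulrA.
rewrite assoc ler_wpM2r //.
by do 3!rewrite mulr_ge0 ?exprn_ge0 ?ler0n //.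
Qed.
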